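(* Let $\gamma$ be a translation invariant specification on $(\Omega,\mathcal F)$ and let $\nu\in\mathcal G_{\mathrm{inv}}(\gamma)$. For every $\mu\in\mathcal M_{1,\mathrm{inv}}^+$: if $h(\mu|\nu)=0$ and $\mu(\Omega_\gamma)=1$, then $\mu\in\mathcal G_{\mathrm{inv}}(\gamma)$ (and thus $\mu$ is almost Gibbs with respect to $\gamma$, i.e. $\mu\in\mathcal G(\gamma)$ and $\mu(\Omega_\gamma)=1$).
   Context: $E$ is a finite set, $\Omega=E^{\mathbb Z^d}$ with product topology and Borel $\sigma$-field $\mathcal F$. $\mathcal S$ is the set of finite subsets of $\mathbb Z^d$; $\mathcal F_\Lambda$ is the $\sigma$-field generated by the coordinates in $\Lambda$; $\sigma_\Lambda$ is the restriction of $\sigma$ to $\Lambda$. A function is local if it is $\mathcal F_\Delta$-measurable for some $\Delta\in\mathcal S$. Translations: $(\tau_x\omega)(y)=\omega(x+y)$. $\mathcal M_{1,\mathrm{inv}}^+$ is the set of translation invariant probability measures on $\Omega$. A specification is a family $\gamma=\{\gamma_\Lambda\}_{\Lambda\in\mathcal S}$ of probability kernels from $\Omega_{\Lambda^c}=E^{\Lambda^c}$ to $\mathcal F$ (so $\gamma_\Lambda(A|\cdot)$ is $\mathcal F_{\Lambda^c}$-measurable) that is proper ($\gamma_\Lambda(B|\omega)=\mathbf 1_B(\omega)$ for $B\in\mathcal F_{\Lambda^c}$, all $\omega$) and consistent ($\gamma_{\Lambda'}\gamma_\Lambda=\gamma_{\Lambda'}$ for $\Lambda\subset\Lambda'$,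 everywhere). $\gamma_\Lambda(\sigma|\omega)$ denotes the $\gamma_\Lambda(\cdot|\omega)$-probability of $\{\omega':\omega'_\Lambda=\sigma_\Lambda\}$, and $\gamma_\Lambda f(\omega)=\int f\,d\gamma_\Lambda(\cdot|\omega)$. All specifications are assumed non-null: for each $\Lambda\in\mathcal S$ there are $0<a_\Lambda<b_\Lambda<1$ with $a_\Lambda<\inf_{\sigma,\eta}\gamma_\Lambda(\sigma|\eta)\le\sup_{\sigma,\eta}\gamma_\Lambda(\sigma|\eta)<b_\Lambda$. $\gamma$ is translation invariant if $\gamma_{\Lambda+x}(A|\omega)=\gamma_\Lambda(\tau_xA|\tau_x\omega)$. $\mathcal G(\gamma)$ is the set of probability measures $\mu$ with $\mu[A|\mathcal F_{\Lambda^c}]=\gamma_\Lambda(A|\cdot)$ $\mu$-a.s. for all $A\in\mathcal F,\Lambda\in\mathcal S$; $\mathcal G_{\mathrm{inv}}(\gamma)$ is the set of its translation invariant elements. $\Omega_\gamma$ is the set of points of continuity of $\gamma$: those $\omega$ such that $\gamma_\Lambda f$ is continuous at $\omega$ for all $\Lambda\in\mathcal S$ and all local $f$. Relative entropy: for $\Lambda\in\mathcal S$, with $\mu_\Lambda,\nu_\Lambda$ the marginals on $E^\Lambda$, $h_\Lambda(\mu|\nu)=\int\frac{d\mu_\Lambda}{d\nu_\Lambda}\log\frac{d\mu_\Lambda}{d\nu_\Lambda}\,d\nu$ if $\mu_\Lambda\ll\nu_\Lambda$ and $+\infty$ otherwise; $h(\mu|\nu)=\lim_{n\to\infty}|\Lambda_n|^{-1}h_{\Lambda_n}(\mu|\nu)$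 when the limit exists, with $\Lambda_n=[-n,n]^d\cap\mathbb Z^d$ (or a Van Hove sequence). $h(\mu|\nu)=0$ means that the limit exists and is $0$. *)

(* Defs.v *)
From HB Require Import structures.
From mathcomp Require Import all_boot all_order all_algebra finmap.
From mathcomp Require Import all_classical all_reals all_analysis.
From mathcomp Require Import measurable_realfun zify.

Set Implicit Arguments.
Unset Strict Implicit.
Unset Printing Implicit Defensive.
Import Order.TTheory GRing.Theory Num.Theory.
Import numFieldNormedType.Exports.

Local Open Scope classical_set_scope.
Local Open Scope ring_scope.

(** The library's measurable types are pointed, hence the single-spin space is
    a nonempty finite type. *)
#[short(type="pfinType")]
HB.structure Definition PointedFinite := {T of Finite T & Pointed T}.

Notation site d := 'rV[int]_d.

Definition config (d : nat) (E : pfinType) : Type :=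
  prod_topology (fun _ : site d => discrete_topology E).
HB.instance Definition _ d E := Topological.copy (config d E)
  (prod_topology (fun _ : site d => discrete_topology E)).
HB.instance Definition _ d E := isPointed.Build (config d E) (fun=> point).
HB.instance Definition _ d E := Measurable.copy (config d E)
  (g_sigma_algebraType (@open (config d E))).

(** [coord_events D] generates the sigma-field F_D of the coordinates in [D]
    ([E] carries the discrete sigma-field); [coord_space E D] is Omega equipped
    with F_D, while [config d E] is Omega equipped with its Borel sigma-field. *)
Definition coord_events d (E : pfinType) (D : set (site d)) :
    set (set (config d E)) :=
  \bigcup_(x in D)
    preimage_set_system setT (fun omega : config d E => omega x) [set: set E].
Arguments coord_events {d} E D.

Definition coord_space d (E : pfinType) (D : set (site d)) :=
  g_sigma_algebraType (coord_events E D).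

Definition patch_config d (E : pfinType) (L : {fset site d}) : Type :=
  {ffun L -> E}.
HB.instance Definition _ d E L := Finite.on (@patch_config d E L).
HB.instance Definition _ d E L :=
  isPointed.Build (@patch_config d E L) [ffun=> point].
HB.instance Definition _ d E L := @isMeasurable.Build default_measure_display
  (@patch_config d E L) discrete_measurable discrete_measurable0
  discrete_measurableC discrete_measurableU.

Definition restr d (E : pfinType) (L : {fset site d}) (omega : config d E) :
  patch_config E L := [ffun x : L => omega (val x)].

Lemma measurable_restr d (E : pfinType) (L : {fset site d}) :
  measurable_fun setT (@restr d E L).
Proof.
move=> _ B _; rewrite setTI.
rewrite (_ : _ @^-1` _ = \bigcup_(s in B) (@restr d E L) @^-1` [set s]); last first.
  by apply/seteqP; split=> [w Bw|w [s Bs /= ->]//]; exists (restr L w).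
apply: fin_bigcup_measurable => [|s _]; first exact: finite_finset.
rewrite (_ : _ @^-1` _ =
    \bigcap_(x in [set: L]) [set w : config d E | w (val x) = s x]); last first.
  apply/seteqP; split=> [w ws x _|w ws]; first by rewrite /= -ws ffunE.
  by apply/ffunP => x; rewrite ffunE; exact: ws x I.
rewrite -[X in measurable X]setCK setC_bigcap; apply: measurableC.
apply: fin_bigcup_measurable => [|x _]; first exact: finite_finset.
apply: measurableC.
apply: sub_sigma_algebra.
apply: (@open_comp (prod_topology (fun _ : site d => discrete_topology E)) _
  (@proj _ (fun=> discrete_topology E) (val x)) [set s x]).
  by move=> w _; exact: proj_continuous.
exact: discrete_open.
Qed.

HB.instance Definition _ d (E : pfinType) (L : {fset site d}) :=
  isMeasurableFun.Build _ _ _ _ (@restr d E L) (@measurable_restr d E L).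


Definition box d (n : nat) : {fset site d} :=
  [fset (\row_i ((f i)%:Z - n%:Z)%R : site d)
    | f : {ffun 'I_d -> 'I_n.*2.+1} in {: {ffun 'I_d -> 'I_n.*2.+1}}]%fset.

Lemma in_box d n (x : site d) :
  (x \in box d n) = [forall i, `|x ord0 i| <= n%:Z].
Proof.
apply/imfsetP/forallP => /= [[f _ ->] i|xn].
  rewrite mxE; have := ltn_ord (f i); lia.
have xi i : (absz (x ord0 i + n%:Z)%R < n.*2.+1)%N by have := xn i; lia.
exists [ffun i => Ordinal (xi i)] => //.
apply/rowP => i; rewrite mxE ffunE /= gez0_abs ?addrK //.
by have := xn i; lia.
Qed.

Definition shift d (E : pfinType) (x : site d) (omega : config d E) :
  config d E := fun y => omega (x + y).

Definition translate d (L : {fset site d}) (x : site d) : {fset site d} :=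
  [fset (y + x)%R | y in L]%fset.

Definition invariant_measure (R : realType) d (E : pfinType)
    (mu : probability (config d E) R) :=
  forall x A, measurable A -> mu (shift x @^-1` A) = mu A.

(** mu[A | sigma(G)] = g holds mu-a.s. for a sigma(G)-measurable [g] exactly
    when [g] is itself a version of the conditional probability. *)
Definition cond_prob_version (R : realType) disp (T : measurableType disp)
    (mu : probability T R) (G : set (set T)) (A : set T) (g : T -> \bar R) :=
  [/\ measurable_fun [set: g_sigma_algebraType G] g,
      mu.-integrable setT g &
      forall B, <<s G >> B -> (\int[mu]_(omega in B) g omega)%E = mu (A `&` B)].

Section specification.
Context (R : realType) (d : nat) (E : pfinType).

Definition kernel_family := forall L : {fset site d},
  R.-pker (coord_space E (~` [set` L])) ~> config d E.

Variable gamma : kernel_family.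

Record is_specification : Prop := IsSpecification {
  spec_proper : forall L B (omega : config d E),
    <<s coord_events E (~` [set` L]) >> B ->
    gamma L omega B = (\1_B omega)%:E ;
  spec_consistent : forall (L L' : {fset site d}) A (omega : config d E),
    (L `<=` L')%fset -> measurable A ->
    (\int[gamma L' omega]_eta gamma L eta A)%E = gamma L' omega A }.

Definition cylinder_prob (L : {fset site d}) (sigma eta : config d E) : \bar R :=
  gamma L eta [set omega | restr L omega = restr L sigma].

(** [L] is nonempty: the empty cylinder has probability 1. *)
Definition nonnull := forall L : {fset site d}, L != fset0 ->
  exists a b : R, [/\ 0 < a, a < b, b < 1,
    (a%:E < ereal_inf [set cylinder_prob L sigma eta
                      | sigma in setT & eta in setT])%E &
    (ereal_sup [set cylinder_prob L sigma eta
               | sigma in setT & eta in setT] < b%:E)%E].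

Definition translation_invariant := forall (L : {fset site d}) x A omega,
  measurable A ->
  gamma (translate L x) omega A = gamma L (shift x omega) (shift x @` A).

Definition Gibbs (mu : probability (config d E) R) :=
  forall L A, measurable A ->
    cond_prob_version mu (coord_events E (~` [set` L])) A
      (fun omega => gamma L omega A).

Definition Gibbs_inv (mu : probability (config d E) R) :=
  Gibbs mu /\ invariant_measure mu.

Definition local_fun (f : config d E -> R) := exists D : {fset site d},
  measurable_fun [set: coord_space E [set` D]] f.

Definition continuity_points : set (config d E) :=
  [set omega | forall (L : {fset site d}) f, local_fun f ->
    {for omega, continuous
      (fun eta : config d E => (\int[gamma L eta]_x f x)%R)}].

Definition almost_Gibbs (mu : probability (config d E) R) :=
  Gibbs mu /\ mu continuity_points = 1%E.

End specification.

Section relative_entropy.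
Local Open Scope charge_scope.

(** [ln] is 0 at 0, so the integrand is 0 where the density vanishes. *)
Definition rel_entropy (R : realType) disp (T : measurableType disp)
    (P Q : probability T R) : \bar R :=
  if `[< P `<< Q >] then
    (\int[Q]_x let r := fine (('d (charge_of_finite_measure P) '/d Q) x) in
      (r * ln r)%:E)%E
  else +oo%E.

End relative_entropy.

Definition local_rel_entropy (R : realType) d (E : pfinType) (L : {fset site d})
    (mu nu : probability (config d E) R) :=
  rel_entropy (distribution mu (@restr d E L)) (distribution nu (@restr d E L)).

Definition has_entropy_density (R : realType) d (E : pfinType)
    (mu nu : probability (config d E) R) (h : \bar R) :=
  ((#|` box d n|%:R^-1)%:E * local_rel_entropy (box d n) mu nu)%E
    @[n --> \oo] --> h.

(* Main.v *)
Require Import Defs.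
From HB Require Import structures.
From mathcomp Require Import all_boot all_order all_algebra finmap.
From mathcomp Require Import all_classical all_reals all_analysis.
From mathcomp Require Import measurable_realfun zify ring lra.

(** Write H(D) for the entropy of [mu] relative to [nu] on the coordinates in the
    finite set D. Let C be a cube containing a given finite L, and e > 0. If
    H(D) - H(D \ L) exceeded e for every D containing C, then, [mu] and [nu] being
    translation invariant, a large box tiled by translates of C would gain more
    than e with each tile, and its entropy would be at least proportional to its
    volume. Zero entropy density thus yields some D containing C with
    H(D) - H(D \ L) <= e ([small_entropy_increment]).

    By the chain rule this difference is the entropy of the law of [mu] on D
    relative to that of r nu, where r = dmu/dnu on D \ L. An inequality of Pinsker
    type turns it into closeness in L1 ([l1_coarse_le]): inside L, given D \ L, the
    measures [mu] and [nu] have nearly the same conditional laws. Hence,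
    for a local event A, mu(A) is close to the integral of r over A under [nu],
    which by the Gibbs property of [nu] is the integral of r gamma_L(A) under [nu].

    The measure r nu coincides with [mu] on D \ L, and D contains an arbitrarily
    large cube. At a continuity point, gamma_L(A) is nearly determined by the
    coordinates in a large cube, and it ignores those in L. As [mu]-almost all
    points are continuity points, the last integral is close to that of gamma_L(A)
    under [mu] ([Gibbs_defect_le]). Therefore mu gamma_L = mu on local events, then
    on all Borel sets ([kernel_invariant]), and properness of [gamma] converts this
    into the Gibbs property of [mu] ([Gibbs_of_kernel_invariant]).

    Non-nullness makes [nu] positive on cylinders, so every density on a finite
    volume is a quotient of point masses and H is a finite sum. *)

Set Implicit Arguments.
Unset Strict Implicit.
Unset Printing Implicit Defensive.
Import Order.TTheory GRing.Theory Num.Theory.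
Import numFieldNormedType.Exports.

Local Open Scope classical_set_scope.
Local Open Scope ring_scope.

(** * Relative entropy on finite sets *)

Section finite_entropy.
Context {R : realType}.
Implicit Types p q t : R.

(** Summed over two probability vectors this bounds the squared Hellinger
    distance by the relative entropy. It is [ln x <= x - 1] at
    [x = sqrt (q / p)]. *)
Lemma sqr_sqrtB_le p q : 0 <= p -> 0 <= q -> (q = 0 -> p = 0) ->
  (Num.sqrt p - Num.sqrt q) ^+ 2 <= p * ln (p / q) - p + q.
Proof.
move=> p0 q0 qp; have [->|pN0] := eqVneq p 0.
  by rewrite sqrtr0 sub0r sqrrN sqr_sqrtr// mul0r subr0 add0r.
have qN0 : q != 0 by apply: contra_neq pN0; exact: qp.
have [a [a0 ->]] : exists a : R, 0 < a /\ p = a ^+ 2.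
  by exists (Num.sqrt p); rewrite sqr_sqrtr// sqrtr_gt0 lt_neqAle eq_sym pN0.
have [b [b0 ->]] : exists b : R, 0 < b /\ q = b ^+ 2.
  by exists (Num.sqrt q); rewrite sqr_sqrtr// sqrtr_gt0 lt_neqAle eq_sym qN0.
rewrite !sqrtr_sqr !gtr0_norm//.
have ba0 : 0 < b / a by rewrite divr_gt0.
have -> : a ^+ 2 / b ^+ 2 = ((b / a) ^+ 2)^-1.
  by field; rewrite !gt_eqF.
rewrite lnV ?posrE ?exprn_gt0// lnXn//.
have := le_ln1Dx (x := b / a - 1).
rewrite ltrBrDl subrr => /(_ ba0); rewrite addrC subrK => lnle.
have : a ^+ 2 * ln (b / a) <= a * b - a ^+ 2.
  have -> : a * b - a ^+ 2 = a ^+ 2 * (b / a - 1) by field; rewrite gt_eqF.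
  by rewrite ler_pM2l ?exprn_gt0.
rewrite mulrN mulrnAr mulr2n; set L := _ * ln _; nra.
Qed.

(** A pointwise substitute for the Pinsker inequality. It comes from
    [|p - q| = |sqrt p - sqrt q| (sqrt p + sqrt q)] and the arithmetic-geometric
    inequality with weight [t]; keeping [t] free spares the Cauchy-Schwarz
    inequality and the final square root. *)
Lemma distr_le_entropy t p q : 0 < t -> 0 <= p -> 0 <= q -> (q = 0 -> p = 0) ->
  `|p - q| <= (p * ln (p / q) - p + q) / (2 * t) + t * (p + q).
Proof.
move=> t0 p0 q0 qp; have := sqr_sqrtB_le p0 q0 qp.
set e := _ - _ + _ => ele.
have -> : `|p - q| = `|Num.sqrt p - Num.sqrt q| * (Num.sqrt p + Num.sqrt q).
  rewrite -[X in _ * X]ger0_norm ?addr_ge0 ?sqrtr_ge0// -normrM.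
  by rewrite -subr_sqr !sqr_sqrtr.
have := sqr_sqrtr p0; have := sqr_sqrtr q0.
move: (sqrtr_ge0 p) (sqrtr_ge0 q) ele; rewrite -(real_normK (num_real (_ - _))).
set a := Num.sqrt p; set b := Num.sqrt q; set u := `|a - b| => a0 b0 ue aE bE.
have u0 : 0 <= u by exact: normr_ge0.
have t20 : 0 < 2 * t by rewrite mulr_gt0.
rewrite -(ler_pM2r t20) [leRHS]mulrDl divfK ?gt_eqF// -aE -bE.
have H1 : 2 * t * u * (a + b) <= u ^+ 2 + t ^+ 2 * (a + b) ^+ 2.
  by have := sqr_ge0 (u - t * (a + b)); nra.
have H2 : t ^+ 2 * (a + b) ^+ 2 <= 2 * t ^+ 2 * (a ^+ 2 + b ^+ 2).
  have : (a + b) ^+ 2 <= 2 * (a ^+ 2 + b ^+ 2).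
    by have := sqr_ge0 (a - b); nra.
  by rewrite -[2 * _ * _]mulrA [2 * (_ * _)]mulrCA ler_pM2l ?exprn_gt0.
nra.
Qed.

Definition entropy (S : finType) (p q : S -> R) : R :=
  \sum_s p s * ln (p s / q s).

Definition pushforward_pmf (S S' : finType) (rho : S -> S') (p : S -> R)
    (s' : S') : R :=
  \sum_(s | rho s == s') p s.

Section coarse_graining.
Variables (S S' : finType) (rho : S -> S') (p q : S -> R).
Hypotheses (p0 : forall s, 0 <= p s) (q0 : forall s, 0 < q s).
Hypotheses (p1 : \sum_s p s = 1).

Let push := pushforward_pmf rho.

(** The law which has the image of [p] as its image under [rho] and the
    conditional laws of [q] on the fibres. *)
Let w s := q s * (push p (rho s) / push q (rho s)).

Let push_q_gt0 s : 0 < push q (rho s).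
Proof.
rewrite /push /pushforward_pmf (bigD1 s)//= ltr_wpDr//.
by apply: sumr_ge0 => i _; exact: ltW.
Qed.

Let push_p_ge0 s' : 0 <= push p s'.
Proof. exact: sumr_ge0. Qed.

Let w_ge0 s : 0 <= w s.
Proof. by rewrite mulr_ge0 ?divr_ge0 ?(ltW (q0 _)) ?(ltW (push_q_gt0 _)). Qed.

Let w_eq0 s : w s = 0 -> p s = 0.
Proof.
move/eqP; rewrite !mulf_eq0 invr_eq0 !(gt_eqF (q0 _), gt_eqF (push_q_gt0 _)).
rewrite orbF/= => /eqP /psumr_eq0P; apply => //.
Qed.

Let sum_push (f : S -> R) (g : S' -> R) :
  \sum_s' push f s' * g s' = \sum_s f s * g (rho s).
Proof.
rewrite (partition_big rho predT)//=; apply: eq_bigr => s' _.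
by rewrite mulr_suml; apply: eq_bigr => s /eqP ->.
Qed.

Let sum_w : \sum_s w s = 1.
Proof.
rewrite -(sum_push q (fun s' => push p s' / push q s')).
rewrite -p1 -[RHS](eq_bigr _ (fun s _ => mulr1 (p s))) -(sum_push p (cst 1))/=.
apply: eq_bigr => s' _; rewrite mulr1.
have [qs'|qs'] := eqVneq (push q s') 0; last by rewrite mulrC divfK.
rewrite qs' mul0r [RHS]big1// => s /eqP ss'; have := push_q_gt0 s.
by rewrite ss' qs' ltxx.
Qed.

(** Chain rule: coarse graining by [rho] loses exactly the entropy of [p]
    relative to [w]. *)
Let entropy_increment :
  entropy p q - entropy (push p) (push q) = \sum_s p s * ln (p s / w s).
Proof.
rewrite /entropy (sum_push p (fun s' => ln (push p s' / push q s'))) -sumrB.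
apply: eq_bigr => s _; rewrite -mulrBr.
have [->|ps] := eqVneq (p s) 0; first by rewrite !mul0r.
have wN0 : w s != 0 by apply: contra_neq ps; exact: w_eq0.
have ps0 : 0 < p s by rewrite lt_neqAle eq_sym ps p0.
have ws0 : 0 < w s by rewrite lt_neqAle eq_sym wN0 w_ge0.
have pps : 0 < push p (rho s).
  by rewrite /push /pushforward_pmf (bigD1 s)//= ltr_wpDr// sumr_ge0.
rewrite -ln_div ?posrE ?divr_gt0 ?push_q_gt0//; congr (_ * ln _).
by rewrite /w [in RHS]invfM mulrA.
Qed.

Lemma entropy_coarse_le :
  entropy (pushforward_pmf rho p) (pushforward_pmf rho q) <= entropy p q.
Proof.
rewrite -subr_ge0 entropy_increment.
have -> : \sum_s p s * ln (p s / w s) =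
    \sum_s (p s * ln (p s / w s) - p s + w s).
  by rewrite big_split sumrB/= sum_w p1 subrK.
apply: sumr_ge0 => s _; apply: le_trans (sqr_ge0 _) _.
apply: sqr_sqrtB_le => //; last exact: w_eq0.
Qed.

(** If coarse graining loses little entropy then, on the fibres of [rho], [p]
    has nearly the conditional laws of [q]. *)
Lemma l1_coarse_le t : 0 < t ->
  \sum_s `|p s - q s * (pushforward_pmf rho p (rho s) /
                        pushforward_pmf rho q (rho s))| <=
  (entropy p q - entropy (pushforward_pmf rho p) (pushforward_pmf rho q))
    / (2 * t) + 2 * t.
Proof.
move=> t0; apply: le_trans (ler_sum _ (fun s _ =>
  distr_le_entropy t0 (p0 s) (w_ge0 s) (@w_eq0 s))) _.
rewrite big_split/= -mulr_suml big_split sumrB -mulr_sumr big_split/=.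
by rewrite -entropy_increment sum_w p1 subrK; lra.
Qed.

End coarse_graining.
End finite_entropy.

(** * Boxes, tilings and small increments *)

Section tiling.
Context {d : nat}.
Implicit Types (D L : {fset site d}) (x y z : site d).

Lemma mem_translate L x z : (z \in translate L x) = (z - x \in L).
Proof.
apply/imfsetP/idP => [[y /= yL ->]|zL]; first by rewrite addrK.
by exists (z - x); rewrite ?subrK.
Qed.

Lemma card_box n : #|` box d n| = (n.*2.+1 ^ d)%N.
Proof.
rewrite card_imfset/=; first by rewrite -cardE card_ffun !card_ord.
move=> f g /rowP fg; apply/ffunP => i; apply/val_inj.
by have := fg i; rewrite !mxE => /addIr [].
Qed.

Lemma box_le m n : (m <= n)%N -> (box d m `<=` box d n)%fset.
Proof.
move=> mn; apply/fsubsetP => x; rewrite !in_box => /forallP xm.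
by apply/forallP => i; rewrite (le_trans (xm i)).
Qed.

Lemma fset_sub_box D : exists n, (D `<=` box d n)%fset.
Proof.
exists (\sum_(x <- D) \sum_i absz (x ord0 i))%N; apply/fsubsetP => x xD.
rewrite in_box; apply/forallP => i; rewrite -abszE lez_nat.
by rewrite (big_rem x)//= (bigD1 i)//= -!addnA leq_addr.
Qed.

Lemma tile_sub_box m k y : y \in box d k ->
  (translate (box d m) (y *+ m.*2.+1) `<=` box d (m + m.*2.+1 * k)%N)%fset.
Proof.
rewrite in_box => /forallP yk; apply/fsubsetP => z; rewrite mem_translate !in_box.
move=> /forallP zm; apply/forallP => i; have := zm i; have := yk i.
rewrite !mxE mulmxnE -mulr_natr natz; move: (z ord0 i) (y ord0 i) => a b bk abm.
rewrite -(subrK (b * m.*2.+1) a) (le_trans (ler_normD _ _))// PoszD PoszM.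
by rewrite lerD// normrM mulrC ler_pM2l.
Qed.

(** Distinct points of the sublattice of step [2 m + 1] differ by more than [2 m]
    in some coordinate, so the cubes of radius [m] around them are disjoint. *)
Lemma tile_inj m y y' z : z \in translate (box d m) (y *+ m.*2.+1) ->
  z \in translate (box d m) (y' *+ m.*2.+1) -> y = y'.
Proof.
rewrite !mem_translate !in_box => /forallP zy /forallP zy'; apply/rowP => i.
have := zy i; have := zy' i.
rewrite !mxE !mulmxnE -(mulr_natr (y ord0 i)) -(mulr_natr (y' ord0 i)) !natz.
move: (z ord0 i) (y ord0 i) (y' ord0 i) => a b c am bm.
apply/eqP/negP => /negP bc.
have bc1 : 1 <= `|b - c|%R by move: bc; lia.
have : `|(b - c) * m.*2.+1| <= m.*2.
  rewrite (_ : _ * _ = (a - c * m.*2.+1) - (a - b * m.*2.+1)); last by ring.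
  by rewrite (le_trans (ler_normB _ _))//; move: am bm; lia.
by rewrite normrM; apply/negP; rewrite -ltNge; nia.
Qed.

(** Only two properties of the relative entropy matter for the tiling argument,
    so it is run for an abstract function [H] of the volume which does not grow
    under restriction or translation. *)
Section small_increment.
Context {R : realType}.
Variable H : {fset site d} -> R.
Hypothesis H_translate : forall D D' x, (translate D' x `<=` D)%fset -> H D' <= H D.
Hypothesis H0 : 0 <= H fset0.

(** Each new tile adds more than [e]: translated to the origin, the union with
    the new tile contains [box d m], and removing the copy of [L] in that tile
    still leaves all the earlier tiles. *)
Lemma tiling_entropy_ge m L (e : R) : (L `<=` box d m)%fset ->
  (forall D, (box d m `<=` D)%fset -> e < H D - H (D `\` L)%fset) ->
  forall ys, uniq ys ->
  e * (size ys)%:R <= H (\bigcup_(y <- ys) translate (box d m) (y *+ m.*2.+1))%fset.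
Proof.
move=> Lm He; elim=> [_|y ys IH /= /andP[yys /IH {}IH]].
  by rewrite big_nil mulr0.
set c := m.*2.+1 in IH *; set U := (\bigcup_(_ <- ys) _)%fset in IH *.
rewrite big_cons -/U; set D := (_ `|` U)%fset.
have CD : (box d m `<=` translate D (- (y *+ c)))%fset.
  apply/fsubsetP => z zm; rewrite mem_translate opprK in_fsetU mem_translate.
  by rewrite addrK zm.
have := He _ CD.
have HD : H (translate D (- (y *+ c))) <= H D.
  apply: (H_translate (x := y *+ c)); apply/fsubsetP => z.
  by rewrite !mem_translate opprK subrK.
have HU : H U <= H (translate D (- (y *+ c)) `\` L)%fset.
  apply: (H_translate (x := - (y *+ c))); apply/fsubsetP => z.
  rewrite mem_translate opprK => zU.
  rewrite in_fsetD mem_translate opprK in_fsetU zU orbT andbT.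
  apply/negP => zL; move/bigfcupP : zU => [y']; rewrite andbT => y'ys zy'.
  suff yy' : y = y' by rewrite yy' y'ys in yys.
  by apply: (tile_inj _ zy'); rewrite mem_translate addrK (fsubsetP Lm).
rewrite -natr1 mulrDr mulr1; lra.
Qed.

(** If every volume containing [box d m] lost more than [e] when [L] is removed,
    the entropy of a large box tiled by copies of [box d m] would be at least [e]
    times the number of tiles, against a vanishing entropy per site. *)
Lemma small_entropy_increment :
  (H (box d n) / (#|` box d n|)%:R) @[n --> \oo] --> (0 : R) ->
  forall m L (e : R), (L `<=` box d m)%fset -> 0 < e ->
  exists2 D, (box d m `<=` D)%fset & H D - H (D `\` L)%fset <= e.
Proof.
move=> /cvgrPdist_lt Hlim m L e Lm e0; apply: contrapT => /forall2NP noD.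
have He D : (box d m `<=` D)%fset -> e < H D - H (D `\` L)%fset.
  by move=> mD; rewrite ltNge; apply/negP; case: (noD D).
have c0 : 0 < (m.*2.+1 ^ d)%:R :> R by rewrite ltr0n expn_gt0.
(* Boxes of this radius are exactly tiled, with centres indexed by box d N. *)
have [N _ /(_ (m + m.*2.+1 * N)%N)] := Hlim _ (divr_gt0 e0 c0).
rewrite /= sub0r normrN => /(_ _)/wrap[]; first nia.
apply/negP; rewrite -leNgt; apply: le_trans (ler_norm _).
rewrite ler_pdivlMr ?ltr0n ?card_box ?expn_gt0//.
have -> : (m + m.*2.+1 * N).*2.+1 = (m.*2.+1 * N.*2.+1)%N by lia.
rewrite expnMn natrM mulrA divfK ?gt_eqF// -card_box.
have := tiling_entropy_ge Lm He (fset_uniq (box d N)).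
move=> /le_trans; apply; apply: (H_translate (x := 0)).
apply/fsubsetP => z; rewrite mem_translate subr0 => /bigfcupP[y].
by rewrite andbT => /tile_sub_box/fsubsetP; exact.
Qed.

End small_increment.
End tiling.

(** * Laws on finite patches *)

Section patches.
Context {d : nat} {E : pfinType}.
Implicit Types (D : {fset site d}) (w : config d E).

Lemma restr_eqP D w w' :
  restr D w = restr D w' <-> (forall x, x \in D -> w x = w' x).
Proof.
split=> [/ffunP ww' x xD|ww']; first by have := ww' [` xD]%fset; rewrite !ffunE.
by apply/ffunP => x; rewrite !ffunE; exact/ww'/valP.
Qed.

Lemma restr_sub D D' w w' : (D' `<=` D)%fset ->
  restr D w = restr D w' -> restr D' w = restr D' w'.
Proof.
move=> /fsubsetP D'D /restr_eqP ww'; apply/restr_eqP => x /D'D; exact: ww'.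
Qed.

(** A section of [restr D]. It lets maps between patches be written as maps
    between configurations, without casts between finite domains. *)
Definition extend D (s : patch_config E D) : config d E :=
  fun x => if insub x is Some y then s y else point.

Lemma extendK D : cancel (@extend D) (@restr d E D).
Proof. by move=> s; apply/ffunP => x; rewrite ffunE /extend valK. Qed.

Lemma measurable_restr_preimage D (S : set (patch_config E D)) :
  measurable (restr D @^-1` S).
Proof. by rewrite -[X in measurable X]setTI; exact: measurable_restr. Qed.

Definition cyl D (s : patch_config E D) : set (config d E) :=
  [set w | restr D w = s].

Lemma measurable_cyl D (s : patch_config E D) : measurable (cyl s).
Proof. exact: (measurable_restr_preimage [set s]). Qed.

Context {R : realType}.
Implicit Types mu nu : probability (config d E) R.

Definition marginal mu D (s : patch_config E D) : R := fine (mu (cyl s)).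

Lemma fine_mu_le mu (A B : set (config d E)) : measurable A -> measurable B ->
  A `<=` B -> fine (mu A) <= fine (mu B).
Proof.
by move=> mA mB AB; rewrite fine_le ?fin_num_measure// le_measure ?inE.
Qed.

Lemma ge0_integral_cyl mu D (A : set (config d E)) (f : config d E -> \bar R) :
  measurable A -> measurable_fun setT f -> (forall w, 0 <= f w)%E ->
  (\int[mu]_(w in A) f w =
   \sum_(s : patch_config E D) \int[mu]_(w in A `&` cyl s) f w)%E.
Proof.
move=> mA mf f0.
have AE : A = \big[setU/set0]_(s : patch_config E D) (A `&` cyl s).
  rewrite -bigcup_seq; apply/seteqP; split=> [w Aw|w [s _ []]//].
  by exists (restr D w) => //=; rewrite mem_index_enum.
rewrite {1}AE ge0_integral_bigsetU//.
- by move=> s; apply: measurableI => //; exact: measurable_cyl.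
- exact: index_enum_uniq.
- by move=> s t _ _ [w [[_ <-] [_ <-]]].
- exact: measurable_funTS.
Qed.

Lemma fine_mu_cyl mu D (A : set (config d E)) : measurable A ->
  fine (mu A) = \sum_(s : patch_config E D) fine (mu (A `&` cyl s)).
Proof.
move=> mA; have mAs (s : patch_config E D) : measurable (A `&` cyl s).
  by apply: measurableI => //; exact: measurable_cyl.
rewrite sum_fine => [|s _]; last exact: fin_num_measure.
rewrite -(mul1e (mu A)) -integral_cst// (ge0_integral_cyl _ D)//.
by congr fine; apply: eq_bigr => s _; rewrite integral_cst// mul1e.
Qed.

Lemma fine_mu_restr mu D (S : pred (patch_config E D)) :
  fine (mu [set w | S (restr D w)]) = \sum_(s | S s) marginal mu s.
Proof.
rewrite (fine_mu_cyl _ D); last exact: (measurable_restr_preimage [set s | S s]).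
rewrite [RHS]big_mkcond; apply: eq_bigr => s _; case: ifPn => Ss.
  congr (fine (mu _)); apply/seteqP; split=> [w []//|w ws].
  by split; rewrite //= ws.
rewrite (_ : _ `&` _ = set0) ?measure0// -subset0 => w [/= + wE].
by rewrite wE (negbTE Ss).
Qed.

Lemma marginal_ge0 mu D (s : patch_config E D) : 0 <= marginal mu s.
Proof. exact: fine_ge0. Qed.

Lemma sum_marginal mu D : \sum_s @marginal mu D s = 1.
Proof.
rewrite -(fine_mu_restr mu predT) (_ : [set _ | _] = setT) ?probability_setT//.
by apply/seteqP; split.
Qed.

Definition local_entropy mu nu D := entropy (@marginal mu D) (@marginal nu D).

Lemma mem_translate_sub D D' (x y : site d) :
  (translate D' x `<=` D)%fset -> y \in D' -> x + y \in D.
Proof.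
by move=> /fsubsetP D'D yD'; apply: D'D; rewrite mem_translate addrC addKr.
Qed.

(** Restriction to a subset and translation are treated at once: the law on [D']
    is an image of the law on any [D] containing a translate of [D']. *)
Lemma marginal_translate mu D D' (x : site d) :
  (forall A : set (config d E), measurable A ->
    mu (Defs.shift x @^-1` A) = mu A) ->
  (translate D' x `<=` D)%fset ->
  @marginal mu D' =
  pushforward_pmf
    (fun s : patch_config E D => restr D' (Defs.shift x (extend s)))
    (@marginal mu D).
Proof.
move=> mu_inv D'D; apply/funext => s'.
rewrite /pushforward_pmf -fine_mu_restr /marginal -mu_inv; last exact: measurable_cyl.
congr (fine (mu _)); apply/seteqP.
have shiftE w : restr D' (Defs.shift x (extend (restr D w))) =
    restr D' (Defs.shift x w).
  apply/restr_eqP => y yD'; rewrite /Defs.shift.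
  have /restr_eqP := extendK (restr D w); apply.
  exact: mem_translate_sub yD'.
by split=> w /=; rewrite shiftE => /eqP.
Qed.

Lemma local_entropy_translate_le mu nu D D' (x : site d) :
  invariant_measure mu -> invariant_measure nu ->
  (forall s : patch_config E D, 0 < marginal nu s) ->
  (translate D' x `<=` D)%fset ->
  local_entropy mu nu D' <= local_entropy mu nu D.
Proof.
move=> mu_inv nu_inv nu0 D'D; rewrite /local_entropy.
rewrite (marginal_translate (mu_inv x) D'D) (marginal_translate (nu_inv x) D'D).
by apply: entropy_coarse_le => //; [exact: marginal_ge0|exact: sum_marginal..].
Qed.

Lemma translate0 D : translate D 0 = D.
Proof.
by apply/fsetP => y; rewrite mem_translate subr0.
Qed.

Lemma shift0 w : Defs.shift 0 w = w.
Proof. by apply/funext => y; rewrite /Defs.shift add0r. Qed.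

Lemma marginal_sub mu D D' : (D' `<=` D)%fset ->
  @marginal mu D' =
  pushforward_pmf (fun s : patch_config E D => restr D' (extend s))
                  (@marginal mu D).
Proof.
move=> D'D; have := @marginal_translate mu D D' 0; rewrite translate0.
have -> : @Defs.shift d E 0 = id by apply/funext => w; exact: shift0.
exact.
Qed.

(** The weights compared with [marginal mu] are those of the measure with density
    [mu_D' / nu_D'] with respect to [nu], where [D'] is the smaller volume. *)
Lemma local_entropy_l1 mu nu D D' (t : R) : (D' `<=` D)%fset -> 0 < t ->
  (forall s : patch_config E D, 0 < marginal nu s) ->
  \sum_(s : patch_config E D) `|marginal mu s - marginal nu s *
      (marginal mu (restr D' (extend s)) / marginal nu (restr D' (extend s)))| <=
  (local_entropy mu nu D - local_entropy mu nu D') / (2 * t) + 2 * t.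
Proof.
move=> D'D t0 nu0; rewrite /local_entropy !(marginal_sub _ D'D).
by apply: l1_coarse_le => //; [exact: marginal_ge0|exact: sum_marginal..].
Qed.

Lemma local_entropy0 mu nu : 0 <= local_entropy mu nu fset0.
Proof.
have marg1 kappa (s : patch_config E fset0) : marginal kappa s = 1.
  rewrite /marginal (_ : cyl s = setT) ?probability_setT//.
  by apply/seteqP; split=> // w _; apply/ffunP => -[].
by apply: sumr_ge0 => s _; rewrite !marg1 divr1 ln1 mulr0.
Qed.

End patches.

(** * Relative entropy of finite marginals as a finite sum *)

Section entropy_identification.
Context {R : realType} {d : nat} {E : pfinType}.
Variables (L : {fset site d}) (mu nu : probability (config d E) R).
Hypothesis nu0 : forall s : patch_config E L, 0 < marginal nu s.

Let P := distribution mu (@restr d E L).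
Let Q := distribution nu (@restr d E L).

Let integral_patch (f : patch_config E L -> R) (A : set (patch_config E L)) :
  (\int[Q]_x (f x)%:E = (\sum_s f s * marginal nu s)%:E)%E.
Proof.
have mS (s : patch_config E L) : measurable [set s] by [].
rewrite (_ : setT = \big[setU/set0]_(s : patch_config E L) [set s]); last first.
  rewrite -bigcup_seq; apply/seteqP; split=> // s _.
  by exists s => //=; rewrite mem_index_enum.
rewrite integral_bigsetU_EFin//.
- rewrite -sumEFin; apply: eq_bigr => s _.
  rewrite (eq_integral (cst (f s)%:E)) => [|t]; last by rewrite inE => ->.
  rewrite integral_cst// EFinM /marginal fineK//.
  by apply: fin_num_measure; exact: measurable_cyl.
- exact: index_enum_uniq.
- by move=> s t _ _ [w [-> ->]].
Qed.

(** On a finite space the density is the quotient of the point masses, and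
    absolute continuity is automatic since [nu] charges every point. *)
Lemma local_rel_entropyE : local_rel_entropy L mu nu = (local_entropy mu nu L)%:E.
Proof.
have PQ : P `<< Q.
  apply/null_content_dominatesP => A mA QA0.
  suff -> : A = set0 by exact: (measure0 P).
  rewrite -subset0 => s As; have := nu0 s; rewrite lt_neqAle => /andP[+ _].
  move=> /negP; apply; rewrite eq_sym eq_le marginal_ge0 andbT.
  have {}QA0 : nu (restr L @^-1` A) = 0 by exact: QA0.
  rewrite -[leRHS]/(fine 0%E) -QA0.
  rewrite /marginal; apply: fine_mu_le; first exact: measurable_cyl.
    exact: measurable_restr_preimage.
  by move=> w /= ->.
rewrite /local_rel_entropy /rel_entropy asboolT// integral_patch; last exact: setT.
congr (_%:E); apply: eq_bigr => s _.
set f := Radon_Nikodym _ _.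
have fE : (P [set s] = f s * Q [set s])%E.
  rewrite [LHS](@Radon_Nikodym_integral _ _ _ (charge_of_finite_measure P) Q)//.
  rewrite (eq_integral (cst (f s))) => [|t]; last by rewrite inE => ->.
  by rewrite integral_cst.
have -> : fine (f s) = marginal mu s / marginal nu s.
  apply: (canRL (mulfK _)); first by rewrite gt_eqF.
  rewrite /marginal -fineM ?Radon_Nikodym_fin_num//.
    by congr fine; exact/esym/fE.
  by apply: fin_num_measure; exact: measurable_cyl.
by rewrite mulrAC divfK ?gt_eqF.
Qed.

End entropy_identification.

(** * Cylinders, topology and sigma-fields *)

Section topology.
Context {d : nat} {E : pfinType}.
Implicit Types (D : {fset site d}) (w : config d E).

Lemma nbhs_restr w D : nbhs w [set w' | restr D w' = restr D w].
Proof.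
have nbhs_site (x : D) : nbhs w [set w' | w' (val x) = w (val x)].
  apply: open_nbhs_nbhs; split => //.
  apply: (@open_comp (prod_topology (fun _ : site d => discrete_topology E)) _
    (@proj _ (fun=> discrete_topology E) (val x)) [set w (val x)]).
    by move=> w' _; exact: proj_continuous.
  exact: discrete_open.
have := @filter_forall (config d E) D _ _ (nbhs_filter w) nbhs_site.
by apply: filterS => w' ww'; apply/ffunP => x; rewrite !ffunE; exact: ww'.
Qed.

(** Cylinders over boxes form a neighbourhood base: they generate a filter which
    converges coordinatewise, hence in the product topology. *)
Lemma nbhs_box w (U : set (config d E)) : nbhs w U ->
  exists n, forall w', restr (box d n) w' = restr (box d n) w -> U w'.
Proof.
pose F : set_system (config d E) := [set V | exists n, forall w',
  restr (box d n) w' = restr (box d n) w -> V w'].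
have FF : Filter F.
  split=> [|A B [n An] [m Bm]|A B AB [n An]]; first by exists 0%N.
  - by exists (maxn n m) => w' ww'; split; [apply: An|apply: Bm];
      apply: restr_sub ww'; apply: box_le; rewrite ?leq_maxl ?leq_maxr.
  - by exists n => w' /An /AB.
suff : F --> w by exact.
apply/cvg_sup => x V; rewrite nbhsE => -[B [[C oC CB] Bw] BV].
have [n xn] := fset_sub_box [fset x]%fset.
exists n => w' /restr_eqP ww'; apply: BV; rewrite -CB/= ww'; last first.
  by apply: (fsubsetP xn); rewrite inE.
by move: Bw; rewrite -CB.
Qed.

(** Membership depends on the coordinates in [D] only, which makes this set
    measurable whatever [g] is. *)
Definition osc_le {R : realType} (g : config d E -> R) D (e : R) :=
  [set w | forall w1 w2, restr D w1 = restr D w -> restr D w2 = restr D w ->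
    `|g w1 - g w2| <= e].

Lemma measurable_osc_le (R : realType) (g : config d E -> R) D e :
  measurable (osc_le g D e).
Proof.
rewrite (_ : osc_le _ _ _ = restr D @^-1` [set s | osc_le g D e (extend s)]).
  exact: measurable_restr_preimage.
by rewrite /osc_le; apply/seteqP; split=> w /=; rewrite extendK.
Qed.

Lemma osc_le_sub (R : realType) (g : config d E -> R) D D' e :
  (D `<=` D')%fset -> osc_le g D e `<=` osc_le g D' e.
Proof.
by move=> DD' w gw w1 w2 w1w w2w; apply: gw; apply: restr_sub; eauto.
Qed.

Lemma osc_le_le (R : realType) (g : config d E -> R) D e e' :
  e <= e' -> osc_le g D e `<=` osc_le g D e'.
Proof. by move=> ee' w gw w1 w2 w1w w2w; rewrite (le_trans _ ee')// gw. Qed.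

Lemma continuous_osc (R : realType) (g : config d E -> R) w :
  {for w, continuous g} <-> forall e, 0 < e -> exists n, osc_le g (box d n) e w.
Proof.
split=> [/cvgrPdist_lt gw e e0|gw].
  have /nbhs_box[n gn] : nbhs w _ := gw _ (divr_gt0 e0 (ltr0Sn R 1)).
  exists n => w1 w2 /gn/= gw1 /gn/= gw2.
  have -> : g w1 - g w2 = (g w - g w2) - (g w - g w1) by ring.
  by rewrite (le_trans (ler_normB _ _))// (splitr e) lerD// ltW.
apply: (proj2 (@cvgrPdist_le R R (config d E) (nbhs w) (nbhs_filter w) g (g w))).
move=> e e0; have [n gn] := gw e e0.
by apply: filterS (nbhs_restr w (box d n)) => w' ww' /=; exact: gn.
Qed.

Lemma measurable_continuous_at (R : realType) (g : config d E -> R) :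
  measurable [set w | {for w, continuous g}].
Proof.
rewrite (_ : mkset _ =
    \bigcap_k \bigcup_n osc_le g (box d n) k.+1%:R^-1); last first.
  apply/seteqP; split=> [w /= /continuous_osc gw k _|w gw].
    by have [|n ?] := gw k.+1%:R^-1; [rewrite invr_gt0|exists n].
  apply/continuous_osc => e e0; have [k ke] : exists k, k.+1%:R^-1 <= e.
    exists (Num.trunc e^-1); rewrite invf_ple ?posrE// ltW//.
    by rewrite truncnS_gt.
  by have [n _ /(osc_le_le ke) ?] := gw k I; exists n.
apply: bigcapT_measurable => k; apply: bigcup_measurable => n _.
exact: measurable_osc_le.
Qed.

End topology.

Section sigma_algebras.
Context {d : nat} {E : pfinType}.
Implicit Types (D : {fset site d}) (w : config d E) (X : set (site d)).

(** The sets that do not separate two configurations agreeing on [X] form a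
    sigma-algebra. *)
Lemma coord_events_agree X (B : set (config d E)) w w' :
  <<s coord_events E X >> B -> (forall x, X x -> w x = w' x) -> B w -> B w'.
Proof.
move=> XB ww'; suff : B w <-> B w' by case.
pose G : set (set (config d E)) := [set C | C w <-> C w'].
suff : <<s coord_events E X >> `<=` G by exact.
apply: smallest_sub.
  split=> [//|A /= AE|F FE] /=.
  - by case: AE => AE1 AE2; split=> -[_ nA]; split=> //; tauto.
  - by split=> -[k _ Fk]; exists k => //; exact/(FE k).
by move=> _ [x Xx [C _ <-]]; rewrite setTI /G/= ww'.
Qed.

Lemma coord_events_restr X D (S : set (patch_config E D)) : [set` D] `<=` X ->
  <<s coord_events E X >> (restr D @^-1` S).
Proof.
move=> DX; pose T := g_sigma_algebraType (coord_events E X).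
change (measurable (restr D @^-1` S : set T)).
have cylE (s : patch_config E D) : measurable (cyl s : set T).
  rewrite (_ : cyl s =
      \bigcap_(x in [set: D]) [set w : config d E | w (val x) = s x]); last first.
    apply/seteqP; split=> [w ws x _|w ws]; first by rewrite /= -ws ffunE.
    by apply/ffunP => x; rewrite ffunE; exact: ws x I.
  apply: fin_bigcap_measurable => [|x _]; first exact: finite_finset.
  apply: sub_sigma_algebra; exists (val x); first exact/DX/valP.
  by exists [set s x]; rewrite ?setTI.
rewrite (_ : _ @^-1` _ = \bigcup_(s in S) cyl s); last first.
  by apply/seteqP; split=> [w Sw|w [s Ss /= ->]//]; exists (restr D w).
by apply: fin_bigcup_measurable => [|s _]; [exact: finite_finset|exact: cylE].
Qed.

Lemma coord_events_borel X (B : set (config d E)) :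
  <<s coord_events E X >> B -> measurable B.
Proof.
apply: smallest_sub; first exact: sigma_algebra_measurable.
move=> _ [x Xx [C _ <-]]; rewrite setTI.
rewrite (_ : _ @^-1` _ = restr [fset x]%fset @^-1`
   [set s : patch_config E [fset x]%fset | C (extend s x)]).
  exact: measurable_restr_preimage.
apply/seteqP; split=> w /=; have /restr_eqP -> // := extendK (restr [fset x]%fset w);
 by rewrite inE.
Qed.

Definition local_events : set (set (config d E)) :=
  [set A | exists n (S : set (patch_config E (box d n))),
     A = restr (box d n) @^-1` S].

Lemma local_events_setI : setI_closed local_events.
Proof.
move=> _ _ [n [S ->]] [m [T ->]].
pose r k (s : patch_config E (box d (maxn n m))) := restr (box d k) (extend s).
exists (maxn n m), (r n @^-1` S `&` r m @^-1` T).
have rE k w : (k <= maxn n m)%N ->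
    r k (restr (box d (maxn n m)) w) = restr (box d k) w.
  by move=> km; apply: restr_sub (extendK _); exact: box_le.
by apply/seteqP; split=> w /=; rewrite !rE ?leq_maxl ?leq_maxr.
Qed.

Lemma borel_local_events :
  @measurable _ (config d E) = <<s local_events >>.
Proof.
apply/seteqP; split; last first.
  apply: smallest_sub; first exact: sigma_algebra_measurable.
  by move=> _ [n [S ->]]; exact: measurable_restr_preimage.
apply: smallest_sub; first exact: smallest_sigma_algebra.
move=> U oU; rewrite (_ : U = \bigcup_n (restr (box d n) @^-1`
    [set s | forall w, restr (box d n) w = s -> U w])); last first.
  apply/seteqP; split=> [w Uw|w [n _ Uw]]; last exact: Uw.
  have /nbhs_box[n nU] : nbhs w U by exact: open_nbhs_nbhs.
  by exists n.
apply: (@bigcup_measurable _ (g_sigma_algebraType local_events)) => n _.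
apply: sub_sigma_algebra.
by exists n, [set s | forall w, restr (box d n) w = s -> U w].
Qed.

End sigma_algebras.

(** * Continuity points *)

Section continuity_points.
Context {R : realType} {d : nat} {E : pfinType}.
Implicit Types (D L : {fset site d}) (w : config d E) (X : set (site d)).

Lemma coord_measurable_agree X disp (T : measurableType disp)
    (f : config d E -> T) w w' :
  measurable [set f w] -> measurable_fun [set: coord_space E X] f ->
  (forall x, X x -> w x = w' x) -> f w' = f w.
Proof.
move=> mfw mf ww'; have := mf measurableT _ mfw; rewrite setTI => Xfw.
exact: (coord_events_agree Xfw ww').
Qed.

Lemma coord_measurable_borel X disp (T : measurableType disp)
    (f : config d E -> T) :
  measurable_fun [set: coord_space E X] f -> measurable_fun [set: config d E] f.
Proof.
move=> mf _ Y mY; rewrite setTI; apply: (@coord_events_borel _ _ X).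
by have := mf measurableT _ mY; rewrite setTI.
Qed.

Lemma Rintegral_local (m : {measure set (config d E) -> \bar R}) D
    (f : config d E -> R) : (m setT < +oo)%E ->
  measurable_fun [set: coord_space E [set` D]] f ->
  \int[m]_w f w = \sum_(s : patch_config E D) f (extend s) * fine (m (cyl s)).
Proof.
move=> mfin mf; have mf' := coord_measurable_borel mf.
have TE : setT = \big[setU/set0]_(s : patch_config E D) (cyl s).
  rewrite -bigcup_seq; apply/seteqP; split=> // w _.
  by exists (restr D w) => //=; rewrite mem_index_enum.
have int_cyl (s : patch_config E D) :
    (\int[m]_(w in cyl s) (f w)%:E = (f (extend s) * fine (m (cyl s)))%:E)%E.
  rewrite (eq_integral (cst (f (extend s))%:E)) => [|w].
    rewrite integral_cst; last exact: measurable_cyl.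
    rewrite EFinM fineK// ge0_fin_numE// (le_lt_trans _ mfin)//.
    by rewrite le_measure ?inE//; exact: measurable_cyl.
  rewrite inE => ws; congr EFin; apply: (coord_measurable_agree _ mf) => // x xD.
  by apply: (restr_eqP D _ _).1 x xD; rewrite extendK.
rewrite /Rintegral TE integral_bigsetU_EFin.
- by rewrite (eq_bigr _ (fun s _ => int_cyl s)) sumEFin.
- exact: measurable_cyl.
- exact: index_enum_uniq.
- by move=> s t _ _ [w [<- <-]].
- by rewrite -TE; apply/measurable_EFinP.
Qed.

Lemma local_fun_indic D (S : set (patch_config E D)) :
  local_fun (\1_(restr D @^-1` S) : config d E -> R).
Proof.
exists D; apply: (@measurable_indic _ (coord_space E [set` D])).
exact: coord_events_restr.
Qed.

Lemma countable_bigcapT_measurable disp (T : measurableType disp) (U : countType)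
    (F : U -> set T) :
  (forall i, measurable (F i)) -> measurable (\bigcap_i F i).
Proof.
move=> mF; rewrite -[X in measurable X]setCK setC_bigcap; apply: measurableC.
by apply: countable_bigcupT_measurable => // i; exact: measurableC.
Qed.

(** Continuity from below of [mu] along the sets [osc_le g (box d n) e]. *)
Lemma osc_le_probability (mu : probability (config d E) R)
    (g : config d E -> R) (e : R) (C : set (config d E)) :
  measurable C -> mu C = 1%E -> C `<=` [set w | {for w, continuous g}] ->
  0 < e -> exists n, fine (mu (~` osc_le g (box d n) e)) <= e.
Proof.
move=> mC muC Cg e0; pose F n := osc_le g (box d n) e.
have mF n : measurable (F n) by exact: measurable_osc_le.
have mUF : measurable (\bigcup_n F n) by exact: bigcup_measurable.
have muUF : mu (\bigcup_n F n) = 1%:E.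
  apply/eqP; rewrite eq_le probability_le1//= -muC le_measure ?inE//.
  by move=> w /Cg/continuous_osc/(_ e e0)[n ?]; exists n.
have Fmono : {homo F : n m / (n <= m)%N >-> (n <= m)%O}.
  by move=> n m nm; apply/subsetPset; apply: osc_le_sub; exact: box_le.
have : mu (F n) @[n --> \oo] --> (1%:E : \bar R).
  by rewrite -muUF; exact: nondecreasing_cvg_mu.
move=> /fine_cvg/cvgrPdist_le/(_ e e0)[n _ /(_ n (leqnn n))] /= ne.
have mFn := mF n; exists n; rewrite -/(F n) probability_setC//.
by rewrite fineB ?fin_num_measure//; exact: le_trans (ler_norm _) ne.
Qed.

Variable gamma : kernel_family R d E.

(** A local function is a finite linear combination of cylinder indicators, so
    countably many kernels of cylinders decide continuity. This is what makes the
    set of continuity points measurable. *)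
Lemma continuity_pointsE : continuity_points gamma =
  \bigcap_L \bigcap_D \bigcap_(s : patch_config E D)
    [set w | {for w, continuous (fun eta => fine (gamma L eta (cyl s)))}].
Proof.
apply/seteqP; split=> [w cw L _ D _ s _ /=|w cw L f [D mf]].
  have := cw L _ (local_fun_indic [set s]); congr (continuous_at _ _).
  apply/funext => eta; rewrite /Rintegral integral_indic ?setIT//.
  exact: measurable_cyl.
have -> : (fun eta => \int[gamma L eta]_x f x) =
    (fun eta => \sum_(s : patch_config E D) f (extend s) * fine (gamma L eta (cyl s))).
  by apply/funext => eta; rewrite (Rintegral_local _ mf)// prob_kernel ltry.
apply: (@cvg_big R _ +%R 0 predT _ _ (nbhs w)).
  exact: add_continuous.
move=> s _; apply: cvgMr; exact: cw.
Qed.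

Lemma measurable_continuity_points : measurable (continuity_points gamma).
Proof.
rewrite continuity_pointsE.
apply: countable_bigcapT_measurable => L; apply: countable_bigcapT_measurable => D.
apply: countable_bigcapT_measurable => s; exact: measurable_continuous_at.
Qed.

End continuity_points.

(** * The Gibbs defect on local events *)

Section variational_principle.
Context {R : realType} {d : nat} {E : pfinType}.
Implicit Types (D L : {fset site d}) (w : config d E) (X : set (site d)).
Implicit Types mu nu : probability (config d E) R.
Variable gamma : kernel_family R d E.

Definition kernel_value L (A : set (config d E)) w : R := fine (gamma L w A).

Lemma kernel_le1 L A w : measurable A -> (gamma L w A <= 1)%E.
Proof.
by move=> mA; rewrite -(@prob_kernel _ _ _ _ _ (gamma L) w) le_measure ?inE.
Qed.

Lemma kernel_valueE L A w : measurable A -> gamma L w A = (kernel_value L A w)%:E.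
Proof.
move=> mA; rewrite /kernel_value fineK// ge0_fin_numE//.
exact: le_lt_trans (kernel_le1 _ _ mA) (ltry _).
Qed.

Lemma kernel_value_bounds L A w : measurable A ->
  0 <= kernel_value L A w <= 1.
Proof.
by move=> mA; rewrite -!lee_fin -kernel_valueE// measure_ge0 kernel_le1.
Qed.

Lemma measurable_kernel_borel L A : measurable A ->
  measurable_fun [set: config d E] (fun w => gamma L w A).
Proof. by move=> mA; apply: coord_measurable_borel; exact: measurable_kernel. Qed.

Lemma kernel_value_agree L A w w' : measurable A ->
  (forall x, x \notin L -> w x = w' x) -> kernel_value L A w' = kernel_value L A w.
Proof.
move=> mA ww'; congr fine.
apply: (coord_measurable_agree _ (measurable_kernel (gamma L) A mA)).
  exact: emeasurable_set1.
by move=> x /= xL; apply: ww'; exact/negP.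
Qed.

Lemma integrable_kernel_value mu L A (B : set (config d E)) :
  measurable A -> measurable B ->
  mu.-integrable B (EFin \o kernel_value L A).
Proof.
move=> mA mB; apply: measurable_bounded_integrable => //.
- exact: le_lt_trans (probability_le1 _ mB) (ltry _).
- apply: measurable_funTS; apply/measurable_EFinP.
  rewrite (_ : _ \o _ = fun w => gamma L w A); first exact: measurable_kernel_borel.
  by apply/funext => w; rewrite kernel_valueE.
- exists 1; split => // x x1 w _; apply: le_trans (ltW x1).
  by have /andP[g0 g1] := kernel_value_bounds L w mA; rewrite /= ger0_norm.
Qed.

Lemma kernel_integralE mu L A (B : set (config d E)) : measurable A ->
  (\int[mu]_(w in B) gamma L w A = \int[mu]_(w in B) (kernel_value L A w)%:E)%E.
Proof. by move=> mA; apply: eq_integral => w _; rewrite kernel_valueE. Qed.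

Lemma Rintegral_cyl mu D L A : measurable A ->
  \int[mu]_w kernel_value L A w =
  \sum_(s : patch_config E D) \int[mu]_(w in cyl s) kernel_value L A w.
Proof.
move=> mA; rewrite /Rintegral (ge0_integral_cyl _ D)//.
- rewrite sum_fine => [|s _].
    by congr fine; apply: eq_bigr => s _; rewrite setTI.
  apply: integrable_fin_num; first exact: measurable_cyl.
  by apply: integrable_kernel_value => //; exact: measurable_cyl.
- by have /integrableP[] := integrable_kernel_value mu L mA measurableT.
- by move=> w; rewrite lee_fin; have /andP[] := kernel_value_bounds L w mA.
Qed.

Lemma Rintegral_cyl_le mu D L A (s : patch_config E D) c e : measurable A ->
  (forall w, cyl s w -> `|kernel_value L A w - c| <= e) ->
  `|\int[mu]_(w in cyl s) kernel_value L A w - c * marginal mu s|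
    <= e * marginal mu s.
Proof.
move=> mA gce; have ms := measurable_cyl s.
have intc (b : R) : mu.-integrable (cyl s) (EFin \o cst b).
  apply: measurable_bounded_integrable => //.
    exact: le_lt_trans (probability_le1 _ ms) (ltry _).
  exists `|b|; split; first exact: num_real.
  by move=> x bx w _; exact: ltW.
have intg := integrable_kernel_value mu L mA ms.
rewrite ler_distl -mulrBl -mulrDl /marginal -!Rintegral_cst//.
apply/andP; split; apply: le_Rintegral => //; [exact: intc| |exact: intc|];
  move=> w /gce; rewrite ler_distl => /andP[]//.
Qed.

(** Since the kernel ignores the coordinates in [L], two configurations agreeing
    on [D] minus [L] can be made to agree on the whole of [D]. *)
Lemma osc_le_setD L A D (e : R) : measurable A ->
  osc_le (kernel_value L A) D e `<=` osc_le (kernel_value L A) (D `\` L)%fset e.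
Proof.
move=> mA w gw w1 w2 w1w w2w.
pose fill (v : config d E) : config d E := fun x => if x \in L then w x else v x.
have gfill v : kernel_value L A v = kernel_value L A (fill v).
  by apply: kernel_value_agree => // x xL; rewrite /fill (negbTE xL).
have fillw v : restr (D `\` L)%fset v = restr (D `\` L)%fset w ->
    restr D (fill v) = restr D w.
  move=> /restr_eqP vw; apply/restr_eqP => x xD; rewrite /fill.
  by case: ifPn => // xL; apply: vw; rewrite in_fsetD xL.
by rewrite (gfill w1) (gfill w2); apply: gw; exact: fillw.
Qed.

(** [nu] of a cylinder is the average of its kernel probabilities, which are
    bounded below. *)
Lemma marginal_gt0 nu : nonnull gamma -> Gibbs gamma nu ->
  forall D (s : patch_config E D), 0 < marginal nu s.
Proof.
move=> gnn nuG D s; have [D0|D0] := eqVneq D fset0.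
  rewrite /marginal (_ : cyl s = setT) ?probability_setT//.
  apply/seteqP; split=> // w _; apply/ffunP => -[x xD]; exfalso.
  by move: xD; rewrite D0.
have [a [b [a0 _ _ ag _]]] := gnn D D0.
have ms := measurable_cyl s.
have [_ _ /(_ setT)] := nuG D _ ms.
rewrite setIT => nus; rewrite -lte_fin /marginal fineK ?fin_num_measure//.
rewrite -nus; last first.
  exact: (@measurableT _ (coord_space E (~` [set` D]))).
apply: lt_le_trans (_ : a%:E <= _)%E; first by rewrite lte_fin.
rewrite -[leLHS]mule1 -(@probability_setT _ _ _ nu) -integral_cst//.
apply: ge0_le_integral => //.
- by move=> w _; rewrite lee_fin ltW.
- exact: measurable_kernel_borel.
move=> w _; apply/ltW; apply: lt_le_trans ag _; apply: ereal_inf_lbound.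
exists (extend s) => //; exists w => //=.
by rewrite /cylinder_prob extendK.
Qed.

Section estimate.
Variables (mu nu : probability (config d E) R).
Hypothesis nuG : Gibbs gamma nu.
Hypothesis nu0 : forall D (s : patch_config E D), 0 < marginal nu s.

(** Let [r] be the density of [mu] with respect to [nu] on the volume [D'],
    which is [D] minus [L], and [g] the kernel value. Since [r] does not depend on
    the coordinates in [L], the Gibbs property of [nu] gives
    [int r g dnu = int_A r dnu].
    The right side is close to [mu A] by the entropy increment; the left side is
    close to [int g dmu] because [r nu] and [mu] agree on [D'] while [g] is nearly
    constant on most of the cylinders over [D']. *)
Lemma Gibbs_defect_le L A (n : nat) D (e : R) : 0 < e ->
  measurable A ->
  (forall w w', restr D w = restr D w' -> A w -> A w') ->
  fine (mu (~` osc_le (kernel_value L A) (box d n) e)) <= e ->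
  (box d n `<=` D)%fset ->
  local_entropy mu nu D - local_entropy mu nu (D `\` L)%fset <= e ^+ 2 ->
  `|fine (mu A) - \int[mu]_w kernel_value L A w| <= 6 * e.
Proof.
move=> e0 mA AD osc nD ent; set D' := (D `\` L)%fset.
have D'D : (D' `<=` D)%fset by exact: fsubsetDl.
set g := kernel_value L A in osc *.
pose r (s' : patch_config E D') : R := marginal mu s' / marginal nu s'.
pose rho (s : patch_config E D) := restr D' (extend s).
have rhoE w : rho (restr D w) = restr D' w by exact: restr_sub (extendK _).
pose I (kappa : probability (config d E) R) (s' : patch_config E D') : R :=
  \int[kappa]_(w in cyl s') g w.
pose good (s' : patch_config E D') := `[< osc_le g D' e (extend s') >].
have goodE w : good (restr D' w) <-> osc_le g D' e w.
  by rewrite (asboolE (osc_le _ _ _ _)) /osc_le /= extendK.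
pose inA (s : patch_config E D) := `[< A (extend s) >].
have inAE w : inA (restr D w) <-> A w.
  by split=> [/asboolP|Aw]; [|apply/asboolP; move: Aw]; apply: AD; rewrite extendK.
(* The Gibbs property of nu enters here only: the cylinder on the patch s'
   outside L belongs to the exterior sigma-field of L. *)
have INu s' : I nu s' = \sum_(s | inA s && (rho s == s')) marginal nu s.
  have [_ _ /(_ (cyl s'))] := nuG L mA.
  rewrite kernel_integralE// => nus'; rewrite /I /Rintegral nus'; last first.
    apply: (coord_events_restr [set s']) => x /=.
    by rewrite in_fsetD => /andP[/negP].
  rewrite -fine_mu_restr; congr (fine (nu _)); apply/seteqP; split=> w /=.
    by rewrite rhoE => -[/inAE -> ->]; rewrite eqxx.
  by rewrite rhoE => /andP[/inAE Aw /eqP].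
have muA : fine (mu A) = \sum_(s | inA s) marginal mu s.
  rewrite -fine_mu_restr; congr (fine (mu _)); apply/seteqP.
  by split=> w /= /inAE.
have rI : \sum_s' r s' * I nu s' = \sum_(s | inA s) marginal nu s * r (rho s).
  rewrite [RHS](partition_big rho predT)//=; apply: eq_bigr => s' _.
  rewrite INu mulr_sumr; apply: eq_bigr => s /andP[_ /eqP <-].
  by rewrite mulrC.
(* Taking t = e balances the two terms: e ^ 2 / (2 e) + 2 e <= 3 e. *)
have l1 : `|fine (mu A) - \sum_s' r s' * I nu s'| <= 3 * e.
  rewrite muA rI -sumrB (le_trans (ler_norm_sum _ _ _))//.
  rewrite (@le_trans _ _ (\sum_s `|marginal mu s - marginal nu s * r (rho s)|))//.
    by rewrite [leRHS](bigID inA)/= lerDl sumr_ge0.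
  rewrite (le_trans (local_entropy_l1 mu D'D e0 (nu0 (D := D))))//.
  have : (local_entropy mu nu D - local_entropy mu nu D') / (2 * e) <= e.
    rewrite ler_pdivrMr ?mulr_gt0//; apply: le_trans ent _.
    by rewrite expr2; nra.
  lra.
(* On a cylinder with small oscillation g is compared with one of its values;
   on the others with 1/2, at distance at most 1/2 from any number in [0, 1]. *)
have l2 s' : `|r s' * I nu s' - I mu s'| <= (2 * e + (~~ good s')%:R) * marginal mu s'.
  have muE : r s' * marginal nu s' = marginal mu s'.
    by rewrite divfK// gt_eqF.
  have r0 : 0 <= r s' by rewrite divr_ge0// ?marginal_ge0// ltW.
  have bound c e' : (forall w, cyl s' w -> `|g w - c| <= e') ->
      `|r s' * I nu s' - I mu s'| <= 2 * e' * marginal mu s'.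
    move=> gc; have := Rintegral_cyl_le nu mA gc; have := Rintegral_cyl_le mu mA gc.
    rewrite -/(I mu s') -/(I nu s') => Imu Inu.
    have -> : r s' * I nu s' - I mu s' =
        r s' * (I nu s' - c * marginal nu s') - (I mu s' - c * marginal mu s').
      by rewrite -muE; ring.
    rewrite (le_trans (ler_normB _ _))// normrM ger0_norm//.
    rewrite (_ : 2 * e' * _ = r s' * (e' * marginal nu s') + e' * marginal mu s').
      by rewrite lerD// ler_wpM2l.
    by rewrite -muE; ring.
  have [gs'|bs'] := boolP (good s').
    rewrite addr0; apply: (bound (g (extend s'))) => w ws.
    by move/asboolP : gs'; apply; rewrite ?extendK.
  have -> : 2 * e + (~~ false)%:R = 2 * e + 2 * 2^-1 by rewrite divff.
  rewrite mulrDl -[leLHS]add0r lerD ?mulr_ge0 ?marginal_ge0 ?(ltW e0)//.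
  apply: (bound 2^-1) => w _; have := kernel_value_bounds L w mA.
  by rewrite -/g ler_distl; lra.
have bad : \sum_s' (~~ good s')%:R * marginal mu s' <= e.
  rewrite (_ : \sum_s' _ = \sum_(s' | ~~ good s') marginal mu s'); last first.
    rewrite [RHS]big_mkcond; apply: eq_bigr => s' _.
    by case: ifP => _; rewrite ?mul1r ?mul0r.
  rewrite -(fine_mu_restr mu (fun s' => ~~ good s')); apply: le_trans osc.
  apply: fine_mu_le.
  - exact: (measurable_restr_preimage [set s' | ~~ good s']).
  - by apply: measurableC; exact: measurable_osc_le.
  move=> w /= /negP bw gw; apply/bw/goodE.
  by apply: osc_le_setD => //; exact: osc_le_sub gw.
rewrite (Rintegral_cyl _ D')// -/I.
rewrite (_ : _ - _ = (fine (mu A) - \sum_s' r s' * I nu s') +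
  \sum_s' (r s' * I nu s' - I mu s')); last by rewrite sumrB; ring.
rewrite (le_trans (ler_normD _ _))// (_ : 6 * e = 3 * e + 3 * e); last by ring.
rewrite lerD// (le_trans (ler_norm_sum _ _ _))//.
apply: le_trans (ler_sum _ (fun s' _ => l2 s')) _.
under eq_bigr do rewrite mulrDl.
rewrite big_split/= -mulr_sumr sum_marginal mulr1; lra.
Qed.

End estimate.
End variational_principle.

(** * The variational principle *)

Section conclusion.
Context {R : realType} {d : nat} {E : pfinType}.
Implicit Types (D L : {fset site d}) (w : config d E) (X : set (site d)).
Variables (gamma : kernel_family R d E) (mu nu : probability (config d E) R).

Hypothesis spec : is_specification gamma.
Hypothesis nuG : Gibbs gamma nu.
Hypothesis nu0 : forall D (s : patch_config E D), 0 < marginal nu s.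
Hypothesis mu_inv : invariant_measure mu.
Hypothesis nu_inv : invariant_measure nu.
Hypothesis entropy0 : has_entropy_density mu nu 0%E.
Hypothesis mu_cont : mu (continuity_points gamma) = 1%E.

Lemma local_entropy_density0 :
  (local_entropy mu nu (box d n) / (#|` box d n|)%:R) @[n --> \oo] --> (0 : R).
Proof.
have := entropy0; rewrite /has_entropy_density => /fine_cvg.
apply: cvg_trans; apply: near_eq_cvg; near=> n.
by rewrite /= local_rel_entropyE// mulrC.
Unshelve. all: by end_near. Qed.

Lemma local_event_defect0 L A : local_events A ->
  fine (mu A) = \int[mu]_w kernel_value gamma L A w.
Proof.
move=> [n0 [S AE]]; have mA : measurable A.
  by rewrite AE; exact: measurable_restr_preimage.
apply/eqP; rewrite -subr_eq0 -normr_le0; apply/ler_addgt0Pr => z z0; rewrite add0r.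
have e0 : 0 < z / 6 by rewrite divr_gt0.
have [n1 osc] : exists n,
    fine (mu (~` osc_le (kernel_value gamma L A) (box d n) (z / 6))) <= z / 6.
  apply: osc_le_probability mu_cont _ _ => //.
    exact: measurable_continuity_points.
  move=> w /= cw; have := cw L _ (local_fun_indic S); rewrite -AE.
  congr (continuous_at _ _); apply/funext => eta.
  by rewrite /Rintegral integral_indic ?setIT.
have [nL LnL] := fset_sub_box L.
pose m := maxn (maxn n0 n1) nL.
have Lm : (L `<=` box d m)%fset.
  by apply: fsubset_trans LnL _; apply: box_le; rewrite leq_maxr.
have Hmono D D' x : (translate D' x `<=` D)%fset ->
    local_entropy mu nu D' <= local_entropy mu nu D.
  exact: local_entropy_translate_le.
have [D mD ent] := small_entropy_increment Hmono (local_entropy0 mu nu)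
  local_entropy_density0 Lm (exprn_gt0 2 e0).
have := @Gibbs_defect_le R d E gamma mu nu nuG nu0 L A n1 D (z / 6) e0 mA _ osc _ ent.
rewrite (_ : 6 * (z / 6) = z); last by field.
apply.
- move=> w w' ww'; rewrite AE /= (restr_sub _ ww')//.
  by apply: fsubset_trans mD; apply: box_le; rewrite /m -maxnA leq_maxl.
- by apply: fsubset_trans mD; apply: box_le; rewrite /m maxnAC leq_maxr.
Qed.

(** Local events form a pi-system generating the Borel sets. *)
Lemma kernel_invariant L A : measurable A -> (\int[mu]_w gamma L w A = mu A)%E.
Proof.
move=> mA; have : <<s @local_events d E >> A by rewrite -borel_local_events.
move: A {mA}; apply: (@dynkin_induction _ (config d E) local_events
  (fun A => (\int[mu]_w gamma L w A = mu A)%E)).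
- exact: borel_local_events.
- exact: local_events_setI.
- under eq_integral do rewrite prob_kernel.
  by rewrite integral_cst// mul1e.
- move=> A lA; have mA : measurable A.
    by have [n [S ->]] := lA; exact: measurable_restr_preimage.
  rewrite kernel_integralE// -[RHS]fineK ?fin_num_measure//.
  rewrite (local_event_defect0 L lA) /Rintegral fineK//.
  by apply: integrable_fin_num => //; exact: integrable_kernel_value.
- move=> A mA; have gC w : gamma L w (~` A) = (1 - kernel_value gamma L A w)%:E.
    have : (gamma L w (~` A) + gamma L w A = 1)%E.
      rewrite -(@prob_kernel _ _ _ _ _ (gamma L) w).
      by rewrite [RHS](measureDI _ measurableT mA) setTD setTI.
    rewrite (kernel_valueE gamma L w mA) (kernel_valueE gamma L w (measurableC mA)).
    by rewrite -EFinD => -[<-]; rewrite addrK.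
  rewrite kernel_integralE// => muA; rewrite probability_setC// -muA.
  rewrite (eq_integral _ _ (fun w _ => gC w)) integralB_EFin//.
  - by rewrite integral_cst// mul1e -[X in (X - _ = _)%E]/(mu setT) probability_setT.
  - exact: finite_measure_integrable_cst.
  - exact: integrable_kernel_value.
- move=> F mF tF HF; have mUF : measurable (\bigcup_k F k).
    exact: bigcup_measurable.
  rewrite measure_semi_bigcup//.
  rewrite (eq_integral (fun w => \sum_(0 <= k <oo) gamma L w (F k))%E); last first.
    by move=> w _; rewrite measure_semi_bigcup.
  rewrite integral_nneseries//.
    by apply: eq_eseriesr => k _; exact: HF.
  by move=> k; exact: measurable_kernel_borel.
Qed.

(** Properness: under [gamma L w] an exterior event [B] has probability 0 or 1
    according to whether it contains [w]. *)
Lemma kernel_setI L A B w : measurable A ->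
  <<s coord_events E (~` [set` L]) >> B ->
  gamma L w (A `&` B) = ((fun w => gamma L w A) \_ B) w.
Proof.
move=> mA XB; have mB := coord_events_borel XB.
have XBC : <<s coord_events E (~` [set` L]) >> (~` B).
  exact: (@measurableC _ (coord_space E (~` [set` L]))).
rewrite patchE; case: ifPn => [wB|wB].
  rewrite [RHS](measureDI _ mA mB).
  rewrite [X in (X + _)%E](_ : _ = 0%E) ?add0e//.
  apply/eqP; rewrite eq_le measure_ge0 andbT.
  rewrite (_ : 0%E = gamma L w (~` B)).
    apply: le_measure; rewrite ?inE; [exact: measurableD|exact: measurableC|].
    by move=> x [].
  by rewrite (spec_proper spec)// indicE in_setC wB.
apply/eqP; rewrite eq_le measure_ge0 andbT; change (gamma L w (A `&` B) <= 0)%E.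
rewrite (_ : 0%E = gamma L w B).
  by apply: le_measure; rewrite ?inE//; exact: measurableI.
by rewrite (spec_proper spec)// indicE (negbTE wB).
Qed.

Lemma Gibbs_of_kernel_invariant : Gibbs gamma mu.
Proof.
move=> L A mA; split.
- exact: (measurable_kernel (gamma L) A mA).
- rewrite (_ : (fun _ => _) = EFin \o kernel_value gamma L A).
    exact: integrable_kernel_value.
  by apply/funext => w; rewrite kernel_valueE.
move=> B XB; have mB := coord_events_borel XB.
rewrite integral_mkcond -(kernel_invariant L)//; last exact: measurableI.
by apply: eq_integral => w _; rewrite kernel_setI.
Qed.

End conclusion.

Theorem theorem1 (R : realType) (d : nat) (E : pfinType)
    (gamma : kernel_family R d E) :
  is_specification gamma -> nonnull gamma -> translation_invariant gamma ->
  forall nu : probability (config d E) R, Gibbs_inv gamma nu ->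
  forall mu : probability (config d E) R, invariant_measure mu ->
    has_entropy_density mu nu 0%E ->
    mu (continuity_points gamma) = 1%E ->
    Gibbs_inv gamma mu /\ almost_Gibbs gamma mu.
Proof.
move=> spec gnn _ nu [nuG nu_inv] mu mu_inv ent mu_cont.
have muG : Gibbs gamma mu.
  apply: (@Gibbs_of_kernel_invariant _ _ _ gamma mu nu) => //.
  exact: marginal_gt0 gnn nuG.
by split; split.
Qed.
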